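(* Consider the sparse normal means model: for $n\ge 1$ one observes $X=(X_1,\ldots,X_n)$ with $X_i=\theta_i+\varepsilon_i$, where $\theta=(\theta_1,\ldots,\theta_n)\in\mathbb{R}^n$ and $\varepsilon_1,\ldots,\varepsilon_n$ are i.i.d. $\mathcal{N}(0,1)$; $P_\theta$, $E_\theta$ denote the law of $X$ and expectation under parameter $\theta$. For $0\le s_n\le n$ let $\ell_0[s_n]=\{\theta\in\mathbb{R}^n:\ \#\{i:\theta_i\neq 0\}\le s_n\}$. Let the slab $G$ be the Laplace distribution $\mathrm{Lap}(1)$, with density $\gamma(x)=\frac12 e^{-|x|}$, and for $\alpha\in[0,1]$ let $\Pi_\alpha=\bigotimes_{i=1}^n\big((1-\alpha)\delta_0+\alpha G\big)$ be the spike and slab prior on $\theta$, with posterior $\Pi_\alpha[\cdot\mid X]$. Let $\hat\alpha$ be the empirical Bayes estimate defined as a maximiser over $[\alpha_n,1]$ of the log-marginal likelihood $\ell_n(\alpha)=\sum_{i=1}^n\log\big((1-\alpha)\phi(X_i)+\alpha g(X_i)\big)$, where $\phi$ is the standard normal density, $g=\phi*\gamma$, and $\alpha_n$ is defined by $t(\alpha_n)=\sqrt{2\log n}$, $t(\alpha)$ being the posterior median threshold described in the context. Then there exist $D>0$, $N_0>0$ and $c_0>0$ such that for any $n\ge N_0$ and any $s_n$ with $1\le s_n\le c_0 n$, there exists $\theta_0\in\ell_0[s_n]$ such that \[ E_{\theta_0}\int\|\theta-\theta_0\|^2\,d\Pi_{\hat\alpha}[\theta\mid X]\ \ge\ D\,s_n\,e^{\sqrt{\log(n/s_n)}},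 \] where $\|\cdot\|$ is the Euclidean norm and $\Pi_{\hat\alpha}[\cdot\mid X]$ denotes the posterior $\Pi_\alpha[\cdot\mid X]$ with $\alpha$ replaced by $\hat\alpha$.
   Context: For fixed $\alpha$, the posterior is $\Pi_\alpha[\cdot\mid X]=\bigotimes_{i=1}^n\big((1-a(X_i))\delta_0+a(X_i)G_{X_i}\big)$, where $a(x)=\frac{\alpha g(x)}{(1-\alpha)\phi(x)+\alpha g(x)}$ and $G_{x}$ has Lebesgue density $\gamma_x(u)=\phi(x-u)\gamma(u)/g(x)$. For fixed $\alpha$, the coordinatewise posterior median of $\theta_i$ is a thresholding rule: there exists $t(\alpha)>0$ such that the posterior median of $\theta_i$ is $0$ if and only if $|X_i|\le t(\alpha)$; $t(\cdot)$ is continuous and strictly decreasing, which defines $\alpha_n$ through $t(\alpha_n)=\sqrt{2\log n}$. *)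

(* Defs.v *)
From HB Require Import structures.
From mathcomp Require Import all_boot all_order all_algebra.
From mathcomp Require Import all_classical all_reals all_analysis.
Set Implicit Arguments. Unset Strict Implicit. Unset Printing Implicit Defensive.
Import Order.TTheory GRing.Theory Num.Theory.
Local Open Scope classical_set_scope.
Local Open Scope ring_scope.

Section SpikeSlab.
Variable R : realType.
Let mu := @lebesgue_measure R.

Definition phi (x : R) : R := expR (- (x ^+ 2) / 2) / Num.sqrt (2 * pi).

Definition gam (u : R) : R := expR (- `|u|) / 2.

Definition gconv (x : R) : R :=
  fine (\int[mu]_(u in setT) (phi (x - u) * gam u)%:E).

Definition gamx (x u : R) : R := phi (x - u) * gam u / gconv x.

Definition apost (alpha x : R) : R :=
  alpha * gconv x / ((1 - alpha) * phi x + alpha * gconv x).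

(** integral of a nonnegative f against the one-coordinate posterior
    (1 - a(x)) delta_0 + a(x) G_x *)
Definition post_int (alpha x : R) (f : R -> \bar R) : \bar R :=
  ((1 - apost alpha x)%:E * f 0%R +
   (apost alpha x)%:E * \int[mu]_(u in setT) (f u * (gamx x u)%:E))%E.

Definition post_prob (alpha x : R) (A : set R) : \bar R :=
  post_int alpha x (fun u => (\1_A u)%:E).

Definition zero_post_median (alpha x : R) : Prop :=
  ((1/2)%:E <= post_prob alpha x `]-oo, 0%R]%classic)%E /\
  ((1/2)%:E <= post_prob alpha x `[0%R, +oo[%classic)%E.

(** alpha_n is characterised by t(alpha_n) = sqrt(2 log n), where t(alpha)
    is the posterior-median threshold: median is 0 iff |x| <= t(alpha). *)
Definition is_alpha_n (n : nat) (alpha_n : R) : Prop :=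
  0 <= alpha_n <= 1 /\
  forall x : R, zero_post_median alpha_n x <-> `|x| <= Num.sqrt (2 * ln n%:R).

Definition loglik (n : nat) (alpha : R) (x : nat -> R) : R :=
  \sum_(i < n) ln ((1 - alpha) * phi (x i) + alpha * gconv (x i)).

Definition is_EB_max (n : nat) (alpha_n : R) (ahat : (nat -> R) -> R) : Prop :=
  forall x : nat -> R,
    alpha_n <= ahat x <= 1 /\
    forall alpha, alpha_n <= alpha <= 1 -> loglik n alpha x <= loglik n (ahat x) x.

Definition in_l0 (n s : nat) (theta0 : nat -> R) : Prop :=
  (\sum_(i < n) (theta0 i != 0%R) <= s)%N.

Definition post_risk (n : nat) (alpha : R) (theta0 x : nat -> R) : \bar R :=
  (\sum_(i < n) post_int alpha (x i) (fun u => ((u - theta0 i) ^+ 2)%:E))%E.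

Definition upd (i : nat) (y : R) (x : nat -> R) : nat -> R :=
  fun j => if j == i then y else x j.

(** E_{theta0} F(X) for X ~ N(theta0, I_n), as iterated Lebesgue integrals
    (coordinates >= n are set to 0); F is nonnegative in our use. *)
Fixpoint gauss_expect (m : nat) (theta0 : nat -> R)
    (F : (nat -> R) -> \bar R) : \bar R :=
  match m with
  | 0 => F (fun _ => 0)
  | m'.+1 => \int[mu]_(y in setT)
      ((phi (y - theta0 m'))%:E *
        gauss_expect m' theta0 (fun x => F (upd m' y x)))%E
  end.

End SpikeSlab.

(* Main.v *)
Require Import Defs.
From HB Require Import structures.
From mathcomp Require Import all_boot all_order all_algebra.
From mathcomp Require Import all_classical all_reals all_analysis.
From mathcomp Require Import measurable_realfun ring lra.
Set Implicit Arguments. Unset Strict Implicit. Unset Printing Implicit Defensive.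
Import Order.TTheory GRing.Theory Num.Theory.
Import numFieldNormedType.Exports.
Local Open Scope ring_scope.

(** Put [s] huge signals in [theta0] and let [L = sqrt (ln (n / s))] and
    [a = (s / n) e^L = e^(L - L^2)]. Each signal contributes about [1 / a] to
    the score [S] of the log-likelihood at [a], hence [s / a] in total, while
    each null coordinate contributes in mean [- a] times the integral of
    [(g - phi)^2 / ((1 - a) phi + a g)], which is about minus the mass of [g]
    beyond the point [sqrt 2 L] where [a g] overtakes [phi]: at least
    [- e^(- b L)] for every [b < sqrt 2] and large [L]. Since
    [s / a = n e^(- L)], the total is positive with large probability, and
    then [ahat >= a] by concavity of the log-likelihood. The posterior of a
    null coordinate with [|X_i| <= 1] has second moment at least of order
    [ahat], so that the risk is at least of order [n a = s e^L]. *)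

(** * Lebesgue integrals carried together with their values *)

Section Integrals.
Context {R : realType}.
Local Notation mu := (@lebesgue_measure R).
Implicit Types (f g : R -> R) (v w : R).

(** Integrability and value are bundled so that linear combinations and comparisons of explicit
    integrals need no separate side conditions. *)
Definition has_integral f v : Prop :=
  mu.-integrable setT (EFin \o f) /\ (\int[mu]_x (f x)%:E = v%:E)%E.

Lemma has_integral_ext f g v : f =1 g -> has_integral f v -> has_integral g v.
Proof. by move=> /funext ->. Qed.

Lemma has_integralD f g v w : has_integral f v -> has_integral g w ->
  has_integral (fun x => f x + g x) (v + w).
Proof.
move=> [fi fv] [gi gw]; split; first exact: (integrableD measurableT fi gi).
under eq_integral do rewrite EFinD.
by rewrite (integralD measurableT fi gi) fv gw.
Qed.

Lemma has_integralZ c f v : has_integral f v ->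
  has_integral (fun x => c * f x) (c * v).
Proof.
move=> [fi fv]; split; first exact: (integrableZl measurableT c fi).
under eq_integral do rewrite EFinM.
by rewrite (integralZl measurableT fi) fv.
Qed.

Lemma has_integral0 : has_integral (fun=> 0) 0.
Proof.
split; last exact: integral0.
apply: eq_integrable (integrable0 mu setT) => //.
Qed.

Lemma has_integral_sum (K : nat) (f : nat -> R -> R) (v : nat -> R) :
  (forall k, has_integral (f k) (v k)) ->
  has_integral (fun x => \sum_(k < K) f k x) (\sum_(k < K) v k).
Proof.
move=> fv; elim: K => [|K IH].
  by rewrite big_ord0; apply: has_integral_ext has_integral0 => x; rewrite big_ord0.
rewrite big_ord_recr; apply: has_integral_ext (has_integralD IH (fv K)) => x.
by rewrite big_ord_recr.
Qed.

Lemma le_has_integral f g v w : (forall x, f x <= g x) ->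
  has_integral f v -> has_integral g w -> v <= w.
Proof.
move=> fg [fi fv] [gi gw]; rewrite -lee_fin -fv -gw.
by apply: le_integral => // x _; rewrite lee_fin.
Qed.

Lemma dominated_has_integral f g w : measurable_fun setT f ->
  (forall x, `|f x| <= g x) -> has_integral g w ->
  exists v, has_integral f v.
Proof.
move=> mf fg [gi _].
have fi : mu.-integrable setT (EFin \o f).
  apply: (le_integrable measurableT _ _ gi); first exact/measurable_EFinP.
  by move=> x _ /=; rewrite lee_fin (le_trans (fg x))// ler_norm.
exists (fine (\int[mu]_x (f x)%:E)); split => //.
by rewrite fineK// integrable_fin_num.
Qed.

Lemma ge0_has_integral f v : (forall x, 0 <= f x) -> measurable_fun setT f ->
  (\int[mu]_x (f x)%:E = v%:E)%E -> has_integral f v.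
Proof.
move=> f0 mf fv; split => //; apply/integrableP; split.
  exact/measurable_EFinP.
under eq_integral do rewrite /= ger0_norm//.
by rewrite fv ltry.
Qed.

Lemma measurable_has_integral f v : has_integral f v -> measurable_fun setT f.
Proof. by case => /integrableP[/measurable_EFinP]. Qed.

(* [F] need not be measurable: its integral is then the supremum of the
   integrals of the simple functions below it. *)
Lemma has_integral_le_integral f v (F : R -> \bar R) : has_integral f v ->
  (forall x, 0 <= F x)%E -> (forall x, (f x)%:E <= F x)%E ->
  (v%:E <= \int[mu]_x F x)%E.
Proof.
(* The positive part of [f] still lies below the nonnegative [F], and its integral is a supremum
   over simple functions. *)
move=> [fi fv] F0 fF; pose p x := Num.max (f x) 0.
have mf : measurable_fun setT f by case/integrableP: fi => /measurable_EFinP.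
have pi : mu.-integrable setT (EFin \o p).
  apply: (le_integrable measurableT _ _ fi).
    by apply/measurable_EFinP; exact: measurable_maxr.
  move=> x _; rewrite /= lee_fin /p; case: (lerP (f x) 0) => // _.
  by rewrite normr0.
rewrite -fv (@le_trans _ _ (\int[mu]_x (p x)%:E)%E)//.
  by apply: le_integral => // x _; rewrite lee_fin /p le_max lexx.
have p0 x : (0 <= (p x)%:E)%E by rewrite lee_fin /p le_max lexx orbT.
rewrite !ge0_integralTE//; apply: ge_ereal_sup => _ [h hp <-].
apply: ereal_sup_ubound; exists h => // x; apply: (le_trans (hp x)).
by rewrite /p EFin_max ge_max fF F0.
Qed.

End Integrals.

(** * Lower bounds for iterated Gaussian expectations *)

Section GaussExpect.
Context {R : realType}.
Implicit Types (theta : nat -> R) (F : (nat -> R) -> \bar R).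

Lemma phi_ge0 (x : R) : 0 <= phi x.
Proof. by rewrite /phi divr_ge0 ?expR_ge0 ?sqrtr_ge0. Qed.

Lemma gauss_expect_ge0 m theta F : (forall x, 0 <= F x)%E ->
  (0 <= gauss_expect m theta F)%E.
Proof.
elim: m F => [|m IH] F F0 /=; first exact: F0.
apply: integral_ge0 => y _.
by rewrite mule_ge0 ?IH// lee_fin phi_ge0.
Qed.

(** A minorant that is a combination of products integrates one coordinate at a time. With the
    outermost variable frozen at [y], the factor [f k m y] is absorbed into the coefficient [c k]
    and the induction hypothesis applies; integrating over [y] then turns it into [e k m]. Only the
    minorant has to be measurable. *)
Lemma gauss_expect_ge theta (K : nat) (f : nat -> nat -> R -> R)
    (e : nat -> nat -> R) :
  (forall k i, has_integral (fun y => phi (y - theta i) * f k i y) (e k i)) ->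
  forall m (c : nat -> R) F, (forall x, 0 <= F x)%E ->
  (forall x : nat -> R, (\sum_(k < K) c k * \prod_(i < m) f k i (x i))%:E <= F x)%E ->
  ((\sum_(k < K) c k * \prod_(i < m) e k i)%:E <= gauss_expect m theta F)%E.
Proof.
move=> fe; elim=> [|m IH] c F F0 cF /=.
  apply: le_trans (cF _); rewrite lee_fin le_eqVlt; apply/orP; left; apply/eqP.
  by apply: eq_bigr => k _; rewrite !big_ord0.
have := has_integral_sum K (fun k => has_integralZ (c k * \prod_(i < m) e k i) (fe k m)).
move=> /has_integral_le_integral H.
have -> : \sum_(k < K) c k * \prod_(i < m.+1) e k i =
          \sum_(k < K) c k * (\prod_(i < m) e k i) * e k m.
  by apply: eq_bigr => k _; rewrite big_ord_recr /= mulrA.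
apply: H => y.
  by rewrite mule_ge0 ?gauss_expect_ge0// lee_fin phi_ge0.
have -> : \sum_(k < K) c k * (\prod_(i < m) e k i) * (phi (y - theta m) * f k m y)
   = phi (y - theta m) * \sum_(k < K) (c k * f k m y) * \prod_(i < m) e k i.
  by rewrite mulr_sumr; apply: eq_bigr => k _; ring.
rewrite EFinM; apply: lee_wpmul2l; first by rewrite lee_fin phi_ge0.
apply: (IH (fun k => c k * f k m y)) => x; first exact: F0.
apply: le_trans (cF _); rewrite lee_fin le_eqVlt; apply/orP; left; apply/eqP.
apply: eq_bigr => k _; rewrite big_ord_recr /= /upd eqxx.
under [in RHS]eq_bigr => i _ do rewrite ltn_eqF//.
by rewrite -mulrA; congr (_ * _); rewrite mulrC.
Qed.

End GaussExpect.

(** * The Gaussian and Laplace densities and their convolution *)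

Section Densities.
Context {R : realType}.
Local Notation mu := (@lebesgue_measure R).
Implicit Types (x u t b : R).

Lemma phi_normal_pdf x t : phi (x - t) = normal_pdf t 1 x.
Proof.
rewrite /phi normal_pdfE// /normal_peak /normal_fun expr1n mul1r.
by rewrite -[pi *+ 2]mulr_natl mulrC.
Qed.

Lemma phi_gt0 x : 0 < phi x.
Proof. by rewrite divr_gt0 ?expR_gt0// sqrtr_gt0 mulr_gt0// pi_gt0. Qed.

Lemma phi_le1 x : phi x <= 1.
Proof.
rewrite /phi ler_pdivrMr ?sqrtr_gt0 ?mulr_gt0 ?pi_gt0// mul1r.
rewrite (@le_trans _ _ 1)//.
  by rewrite expR_le1 mulNr oppr_le0 divr_ge0// sqr_ge0.
rewrite -[leLHS]sqrtr1 ler_sqrt ?mulr_ge0 ?pi_ge0//.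
by have := pi_ge2 R; lra.
Qed.

Lemma phi_le x t : `|t| <= `|x| -> phi x <= phi t.
Proof.
move=> tx; rewrite /phi ler_pM2r ?invr_gt0 ?sqrtr_gt0 ?mulr_gt0 ?pi_gt0//.
rewrite ler_expR !mulNr lerN2 ler_pM2r ?invr_gt0//.
by rewrite -(real_normK (num_real t)) -(real_normK (num_real x)) lerXn2r ?nnegrE.
Qed.

Lemma phi_subC x t : phi (x - t) = phi (t - x).
Proof. by rewrite /phi -(sqrrN (x - t)) opprB. Qed.

(** Completing the square: an exponential tilt shifts the Gaussian by one. *)
Lemma phiN_expR x t : phi (x - t) * expR (- t) = expR (- x + 1 / 2) * phi (t - (x - 1)).
Proof.
by rewrite /phi mulrAC [RHS]mulrA -!expRD; congr (expR _ / _); field.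
Qed.

Lemma phi_expR x t : phi (x - t) * expR t = expR (x + 1 / 2) * phi (t - (x + 1)).
Proof.
by rewrite /phi mulrAC [RHS]mulrA -!expRD; congr (expR _ / _); field.
Qed.

Lemma has_integral_phi t : has_integral (fun x => phi (x - t)) 1.
Proof.
split.
  apply: eq_integrable (integrable_normal_pdf t 1) => // x _ /=.
  by rewrite phi_normal_pdf.
by under eq_integral do rewrite phi_normal_pdf; rewrite integral_normal_pdf.
Qed.

Lemma measurable_phi : measurable_fun setT (@phi R).
Proof.
have := measurable_has_integral (has_integral_phi 0).
by apply: eq_measurable_fun => x _; rewrite subr0.
Qed.

(** By symmetry this is twice an integral over the half-line, where the integrand is [b^-1] times
    the exponential density. *)
Lemma has_integral_expRNnormr b : 0 < b ->
  has_integral (fun x => expR (- b * `|x|)) (2 / b).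
Proof.
move=> b0; have cf : continuous (fun x : R => expR (- b * `|x|)).
  move=> x; apply: (cvg_comp _ expR); last exact: continuous_expR.
  by apply: cvgM; [exact: cvg_cst|exact: (@norm_continuous _ R^o)].
apply: ge0_has_integral => [x||]; first exact: expR_ge0.
  exact: continuous_measurable_fun.
rewrite ge0_symfun_integralT//; last by move=> x /=; rewrite normrN.
rewrite EFinM; congr (_ * _)%E; rewrite -set_itvcy.
transitivity (\int[mu]_(x in `[0%R, +oo[) ((b^-1)%:E * (exponential_pdf b x)%:E))%E.
  apply: eq_integral => x /[!inE] /=; rewrite in_itv /= andbT => x0.
  by rewrite exponential_pdfE// ger0_norm// -EFinM mulKf// gt_eqF.
rewrite integral_mkcond.
transitivity (\int[mu]_x ((b^-1)%:E * (exponential_pdf b x)%:E))%E.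
  apply: eq_integral => x _; rewrite patchE; case: ifPn => // xI.
  by rewrite /exponential_pdf patchE (negbTE xI) mule0.
rewrite ge0_integralZl//.
- by rewrite integral_exponential_pdf// mule1.
- by apply/measurable_EFinP; exact: measurable_exponential_pdf.
- by move=> x _; rewrite lee_fin exponential_pdf_ge0// ltW.
- by rewrite lee_fin invr_ge0 ltW.
Qed.

Lemma gam_gt0 u : 0 < gam u.
Proof. by rewrite divr_gt0 ?expR_gt0. Qed.

Lemma gam_ge0 u : 0 <= gam u.
Proof. exact/ltW/gam_gt0. Qed.

Lemma gam_le u : gam u <= 1 / 2.
Proof.
by rewrite ler_pM2r ?invr_gt0// expR_le1 oppr_le0.
Qed.

Lemma has_integral_gam : has_integral (@gam R) 1.
Proof.
have := has_integralZ (1 / 2) (has_integral_expRNnormr (ltr01 : 0 < (1 : R))).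
rewrite divr1 mul1r mulVf//.
by apply: has_integral_ext => x; rewrite mulN1r mulrC.
Qed.

Lemma measurable_gam : measurable_fun setT (@gam R).
Proof. exact: measurable_has_integral has_integral_gam. Qed.

Lemma has_integral_gconv x : has_integral (fun u => phi (x - u) * gam u) (gconv x).
Proof.
have [v [vi ve]] : exists v, has_integral (fun u => phi (x - u) * gam u) v.
  apply: (dominated_has_integral _ _ (has_integral_phi x)) => [|u].
    apply: measurable_funM measurable_gam.
    apply: measurableT_comp; first exact: measurable_phi.
    exact: measurable_funB.
  rewrite (ger0_norm (mulr_ge0 (phi_ge0 _) (gam_ge0 _))) phi_subC.
  rewrite ler_piMr ?phi_ge0// (le_trans (gam_le u))//; lra.
by split => //; rewrite /gconv ve.
Qed.

Lemma has_integral_indic (A : set R) v : measurable A -> mu A = v%:E ->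
  has_integral \1_A v.
Proof.
move=> mA Av; apply: ge0_has_integral => [x||].
- by rewrite indicE.
- exact: measurable_indic.
- by rewrite integral_indic// setIT.
Qed.

Lemma has_integral_itv (a b : R) : a <= b ->
  has_integral \1_`[a, b]%classic (b - a).
Proof.
move=> ab; apply: has_integral_indic => //.
rewrite lebesgue_measure_itv /= lte_fin; case: ltP => //= ba.
by rewrite (@le_anti _ _ b a) ?ba ?ab// subrr.
Qed.

Lemma expR_half_le2 : expR (1 / 2) <= 2 :> R.
Proof.
rewrite -[leLHS]invrK -expRN -[leRHS]invrK lef_pV2 ?posrE ?invr_gt0 ?expR_gt0//.
by have := expR_ge1Dx (- (1 / 2) : R); lra.
Qed.

(** On the side of the sign of [x], [gam] is dominated by a pure exponential, whose convolution with
    the Gaussian is explicit after completing the square; the resulting factor [expR (1 / 2) / 2] is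
    at most 1. *)
Lemma gconv_le x : gconv x <= expR (- `|x|).
Proof.
have e2 := expR_half_le2.
have aux y v : (forall u, phi (x - u) * gam u <= expR (y + 1 / 2) / 2 * phi (u - v)) ->
    y = - `|x| -> gconv x <= expR (- `|x|).
  move=> H <-; have := le_has_integral H (has_integral_gconv x)
    (has_integralZ _ (has_integral_phi v)).
  move=> /le_trans; apply; rewrite mulr1 expRD -mulrA ler_piMr ?expR_ge0//; lra.
have [x0|x0] := lerP 0 x.
  apply: (aux (- x) (x - 1)) => [u|]; last by rewrite ger0_norm.
  rewrite [leRHS]mulrAC -phiN_expR /gam mulrA ler_pM2r ?invr_gt0// ler_wpM2l ?phi_ge0//.
  by rewrite ler_expR lerN2 ler_norm.
apply: (aux x (x + 1)) => [u|]; last by rewrite ltr0_norm// opprK.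
rewrite [leRHS]mulrAC -phi_expR /gam mulrA ler_pM2r ?invr_gt0// ler_wpM2l ?phi_ge0//.
by rewrite ler_expR lerNl -normrN ler_norm.
Qed.

(** Only [u] in [[x, x + 1]] is kept, where [|x - u| <= 1] and [|u| <= |x| + 1]. *)
Lemma gconv_ge x : phi (1 : R) / 2 * expR (- `|x| - 1) <= gconv x.
Proof.
have x1 : x <= x + 1 by rewrite lerDl.
have H := has_integralZ (phi (1 : R) / 2 * expR (- `|x| - 1)) (has_integral_itv x1).
rewrite [x + 1 - x]addrAC subrr add0r mulr1 in H.
apply: le_has_integral H (has_integral_gconv x) => u; rewrite indicE.
case: (boolP (u \in _)) => [|_]; last first.
  by rewrite mulr0; exact: mulr_ge0 (phi_ge0 _) (gam_ge0 _).
rewrite inE /= in_itv /= => /andP[xu ux]; rewrite mulr1 /gam [leRHS]mulrA mulrAC.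
rewrite ler_pM2r ?invr_gt0// ler_pM ?phi_ge0 ?expR_ge0//.
  apply: phi_le; rewrite (ger0_norm ler01) distrC.
  rewrite ger0_norm; lra.
rewrite ler_expR; have := ler_normD x (u - x).
by rewrite addrC subrK (@ger0_norm _ (u - x)); lra.
Qed.

Lemma gconv_gt0 x : 0 < gconv x.
Proof.
apply: lt_le_trans (gconv_ge x).
by rewrite mulr_gt0 ?expR_gt0// divr_gt0 ?phi_gt0.
Qed.

Lemma gconv_le1 x : gconv x <= 1.
Proof. by apply: le_trans (gconv_le x) _; rewrite expR_le1 oppr_le0. Qed.

(** Joint density of an observation and its mean under the slab; Tonelli gives both the
    measurability and the total mass of its marginal [gconv]. *)
Let G (z : R * R) : \bar R := (phi (z.1 - z.2) * gam z.2)%:E.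

Let measurable_G : measurable_fun setT G.
Proof.
apply/measurable_EFinP; apply: measurable_funM.
  by apply: measurableT_comp; [exact: measurable_phi|exact: measurable_funB].
by apply: measurableT_comp; first exact: measurable_gam.
Qed.

Let G_ge0 z : (0 <= G z)%E.
Proof. by rewrite lee_fin; exact: mulr_ge0 (phi_ge0 _) (gam_ge0 _). Qed.

Lemma measurable_gconv : measurable_fun setT (@gconv R).
Proof.
have := measurable_fun_fubini_tonelli_F (m2 := mu) _ measurable_G G_ge0.
exact: (measurableT_comp (fine_measurable measurableT)).
Qed.

Lemma has_integral_gconvT : has_integral (@gconv R) 1.
Proof.
apply: ge0_has_integral => [x||]; first exact/ltW/gconv_gt0.
  exact: measurable_gconv.
transitivity (\int[mu]_x \int[mu]_u G (x, u))%E.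
  by apply: eq_integral => x _; case: (has_integral_gconv x) => _ <-.
rewrite (fubini_tonelli (m1 := mu) (m2 := mu) _ measurable_G G_ge0).
rewrite -[RHS](has_integral_gam.2).
apply: eq_integral => u _; have [] := has_integralZ (gam u) (has_integral_phi u).
by move=> _; rewrite mulr1 => <-; apply: eq_integral => x _; rewrite /G /= mulrC.
Qed.

End Densities.

(** * The marginal likelihood, its maximiser and the posterior second moment *)

Section Posterior.
Context {R : realType}.
Implicit Types (a x u : R).

Definition mix a x := (1 - a) * phi x + a * gconv x.

(** The derivative of [ln (mix a x)] with respect to [a]. *)
Definition score a x := (gconv x - phi x) / mix a x.

Lemma mix_gt0 a x : 0 <= a <= 1 -> 0 < mix a x.
Proof.
move=> /andP[a0 a1]; rewrite /mix; have p := phi_gt0 x; have g := gconv_gt0 x.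
have [->|a2] := eqVneq a 0; first by rewrite subr0 mul1r mul0r addr0.
have a3 : 0 < a by rewrite lt_neqAle eq_sym a2.
by rewrite ltr_wpDl ?mulr_gt0// mulr_ge0 ?subr_ge0// ltW.
Qed.

Lemma mix_le1 a x : 0 <= a <= 1 -> mix a x <= 1.
Proof.
move=> /andP[a0 a1]; rewrite /mix; have p := phi_le1 x; have g := gconv_le1 x.
have := ler_wpM2l a0 g; have := @ler_wpM2l _ (1 - a) _ _ _ p.
by rewrite subr_ge0 a1 => /(_ isT); lra.
Qed.

(** For [a <= 1 / 2] the mixture is at least [phi x / 2], while the numerator is at least
    [- phi x]. *)
Lemma score_ge a x : 0 <= a <= 1 / 2 -> - 2 <= score a x.
Proof.
move=> /andP[a0 a1]; have m0 : 0 < mix a x by apply: mix_gt0; lra.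
rewrite ler_pdivlMr// /mix; have p := phi_gt0 x; have g := gconv_gt0 x.
have := mulr_ge0 a0 (ltW g); have : 0 <= (1 - 2 * a) * phi x.
  by rewrite mulr_ge0 ?(ltW p)//; lra.
lra.
Qed.

Lemma measurable_score a : 0 <= a <= 1 -> measurable_fun setT (score a).
Proof.
move=> a01; have mp := @measurable_phi R; have mg := @measurable_gconv R.
have mm : measurable_fun setT (mix a).
  by apply: measurable_funD; exact: measurable_funM.
apply: measurable_funM; first exact: measurable_funB.
(* The inverse is written as the power [- 1], which agrees with it because [mix] is positive. *)
have : measurable_fun setT (fun x => mix a x `^ (- 1)).
  exact: (measurableT_comp (measurable_powR (- 1)) mm).
by apply: eq_measurable_fun => x _ /=; rewrite powR_inv1// ltW// mix_gt0.
Qed.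

(* [ln] lies below its tangents:
   a supergradient inequality for the concave log-likelihood. *)
Lemma loglik_sub_le n a b (x : nat -> R) : 0 <= a <= 1 -> 0 <= b <= 1 ->
  loglik n a x - loglik n b x <= (a - b) * \sum_(i < n) score b (x i).
Proof.
move=> a01 b01; rewrite /loglik -sumrB mulr_sumr; apply: ler_sum => i _.
rewrite -/(mix a (x i)) -/(mix b (x i)).
have ma := mix_gt0 (x i) a01; have mb := mix_gt0 (x i) b01.
rewrite -ln_div// -[_ / _](subrKC 1) (le_trans (le_ln1Dx _))//.
  by rewrite ltrBrDl subrr divr_gt0.
rewrite le_eqVlt; apply/orP; left; apply/eqP.
by rewrite /score /mix in mb *; field; rewrite gt_eqF.
Qed.

(** If [ahat x < b], then [b] is itself an admissible competitor, and the supergradient inequality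
    at [b] makes its likelihood strictly larger. *)
Lemma EB_max_ge n an ahat b (x : nat -> R) : 0 <= an -> 0 <= b <= 1 ->
  is_EB_max n an ahat -> 0 < \sum_(i < n) score b (x i) -> b <= ahat x.
Proof.
move=> an0 b01 /(_ x)[/andP[ha ha1] hmax] S0.
rewrite leNgt; apply/negP => ab.
have a01 : 0 <= ahat x <= 1 by rewrite ha1 (le_trans an0).
have := loglik_sub_le n x a01 b01.
have /hmax : an <= b <= 1 by rewrite (le_trans ha (ltW ab)); case/andP: b01.
rewrite -subr_ge0 => /le_trans h/h.
by rewrite pmulr_lge0// subr_ge0 leNgt ab.
Qed.

Lemma apost_itv a x : 0 <= a <= 1 -> 0 <= apost a x <= 1.
Proof.
move=> a01; have m := mix_gt0 x a01; move: (a01) => /andP[a0 a1].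
rewrite /apost -/(mix a x) divr_ge0 ?(ltW m) ?mulr_ge0 ?(ltW (gconv_gt0 x))//=.
rewrite ler_pdivrMr// mul1r /mix lerDr mulr_ge0 ?subr_ge0//.
exact/ltW/phi_gt0.
Qed.

Lemma gamx_ge0 x u : 0 <= gamx x u.
Proof.
by rewrite divr_ge0 ?(mulr_ge0 (phi_ge0 _) (gam_ge0 _)) ?(ltW (gconv_gt0 _)).
Qed.

Lemma post_int_ge0 a x (f : R -> \bar R) : 0 <= a <= 1 -> (forall u, 0 <= f u)%E ->
  (0 <= post_int a x f)%E.
Proof.
move=> /(apost_itv x)/andP[a0 a1] f0.
rewrite /post_int adde_ge0// mule_ge0 ?lee_fin ?subr_ge0//.
by apply: integral_ge0 => u _; rewrite mule_ge0// lee_fin gamx_ge0.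
Qed.

(** The slab part alone suffices, restricted to [u] in [[1, 2]]: there [u ^+ 2 >= 1] and
    [|x - u| <= 3]. The factor [gconv x] cancels between [apost] and [gamx], and the remaining
    denominator [mix a x] is at most 1. *)
Lemma post_int_sqr_ge : exists2 c : R, 0 < c & forall a x, 0 <= a <= 1 -> `|x| <= 1 ->
  ((c * a)%:E <= post_int a x (fun u => ((u - 0) ^+ 2)%:E))%E.
Proof.
exists (phi (3 : R) * gam (2 : R)); first exact: mulr_gt0 (phi_gt0 _) (gam_gt0 _).
move=> a x a01 x1; have m := mix_gt0 x a01; have g := gconv_gt0 x.
have /andP[p0 p1] := apost_itv x a01; move: (a01) => /andP[a0 a1].
rewrite /post_int; set c := phi _ * _.
have c0 : 0 <= c by exact: mulr_ge0 (phi_ge0 _) (gam_ge0 _).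
have H := has_integralZ (c / gconv x) (has_integral_itv (_ : 1 <= 2 :> R)).
have {}H := H ltac:(lra).
apply: (@le_trans _ _ ((apost a x)%:E * (c / gconv x)%:E)%E).
  rewrite -EFinM lee_fin /apost -/(mix a x).
  have -> : a * gconv x / mix a x * (c / gconv x) = c * a * (mix a x)^-1.
    by field; rewrite !gt_eqF.
  by rewrite ler_peMr ?mulr_ge0// invf_ge1// mix_le1.
rewrite -[leLHS]add0e leeD//.
  by rewrite mule_ge0// lee_fin ?subr_ge0// subrr expr0n.
rewrite lee_wpmul2l ?lee_fin//.
have -> : c / gconv x = c / gconv x * (2 - 1) by ring.
apply: (has_integral_le_integral H) => u.
  by rewrite -EFinM lee_fin mulr_ge0 ?sqr_ge0 ?gamx_ge0.
rewrite -EFinM lee_fin indicE.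
case: (boolP (u \in _)) => [|_]; last first.
  by rewrite mulr0 mulr_ge0 ?sqr_ge0 ?gamx_ge0.
rewrite inE /= in_itv /= => /andP[u1 u2]; rewrite mulr1 subr0.
apply: (@le_trans _ _ (1 * gamx x u)).
  rewrite mul1r /gamx ler_pM2r ?invr_gt0//.
  apply: (ler_pM (phi_ge0 _) (gam_ge0 _)).
    apply: phi_le; rewrite (@ger0_norm _ 3)//.
    by rewrite (le_trans (ler_normB _ _))// (@ger0_norm _ u); lra.
  by rewrite /gam ler_pM2r ?invr_gt0// ler_expR !ger0_norm; lra.
by rewrite ler_wpM2r ?gamx_ge0// -(expr1n _ 2) lerXn2r ?nnegrE; lra.
Qed.

End Posterior.

(** * The first two moments of the score under the null *)

Section ScoreMoments.
Context {R : realType}.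
Implicit Types (a x L kap : R).

Lemma phi0E x : phi x = phi 0 * expR (- (x ^+ 2) / 2).
Proof.
by rewrite /phi expr0n /= oppr0 mul0r expR0 mul1r mulrC.
Qed.

Lemma phi_le_expRNnormr x : phi x <= 2 * expR (- `|x|).
Proof.
rewrite phi0E; apply: (@le_trans _ _ (1 * (2 * expR (- `|x|)))); last by rewrite mul1r.
rewrite ler_pM ?phi_ge0 ?expR_ge0 ?phi_le1//.
have e2 := @expR_half_le2 R.
apply: (@le_trans _ _ (expR (1 / 2) * expR (- `|x|))); last first.
  by rewrite ler_wpM2r ?expR_ge0.
rewrite -expRD ler_expR -(real_normK (num_real x)).
by have := sqr_ge0 (`|x| - 1); nra.
Qed.

(** Since [gconv - phi] has integral zero, the integral of this defect is minus the null mean of the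
    score; up to the factor [2 / a] it also bounds the second moment. *)
Definition score_defect a x := a * (gconv x - phi x) ^+ 2 / mix a x.

Lemma score_defect_ge0 a x : 0 <= a <= 1 -> 0 <= score_defect a x.
Proof.
move=> a01; rewrite divr_ge0 ?(ltW (mix_gt0 x a01))// mulr_ge0 ?sqr_ge0//.
by case/andP: a01.
Qed.

Lemma phiM_score a x : 0 <= a <= 1 ->
  phi x * score a x = gconv x - phi x - score_defect a x.
Proof.
move=> a01; have := mix_gt0 x a01; rewrite /score /score_defect /mix => m.
by field; rewrite gt_eqF.
Qed.

Lemma phiM_score_sqr a x : 0 <= a <= 1 / 2 ->
  a * (phi x * score a x ^+ 2) <= 2 * score_defect a x.
Proof.
move=> /andP[a0 a1]; have m : 0 < mix a x by apply: mix_gt0; lra.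
have p := phi_gt0 x; have g := gconv_gt0 x.
have pm : phi x <= 2 * mix a x.
  rewrite /mix; have := mulr_ge0 a0 (ltW g).
  have : 0 <= (1 - 2 * a) * phi x by rewrite mulr_ge0 ?(ltW p)//; lra.
  lra.
have -> : a * (phi x * score a x ^+ 2) = (phi x / mix a x) * score_defect a x.
  by rewrite /score /score_defect; field; rewrite gt_eqF.
rewrite ler_wpM2r//; first by apply: score_defect_ge0; lra.
by rewrite ler_pdivrMr.
Qed.

(* With [a = expR (L - L ^+ 2)], the likelihood ratio [gconv / phi] is at most
   about [1 / a] where [|x| <= 5 L / 4]; beyond, the Laplace tail of [gconv]
   is at most [expR (- 5 L / 4)]. Any cut-off strictly between [L] and
   [sqrt 2 L] would do. *)
Lemma score_defect_le : exists2 C : R, 0 < C & forall L x, 10 <= L ->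
  expR (L - L ^+ 2) <= 1 / 2 ->
  score_defect (expR (L - L ^+ 2)) x <=
    C * expR (- (9 / 8 * L)) * expR (- (1 / 10) * `|x|).
Proof.
have p0 := phi_gt0 (0 : R).
exists (2 / phi 0 + 5); first by rewrite addr_gt0// divr_gt0.
move=> L x L10; set a := expR _ => a12.
have a0 : 0 < a by exact: expR_gt0.
have m : 0 < mix a x by apply: mix_gt0; lra.
have p := phi_gt0 x; have g := gconv_gt0 x.
have pm : phi x <= 2 * mix a x.
  rewrite /mix; have := mulr_ge0 (ltW a0) (ltW g).
  have : 0 <= (1 - 2 * a) * phi x by rewrite mulr_ge0 ?(ltW p)//; lra.
  lra.
have gm : a * gconv x <= mix a x.
  by rewrite /mix lerDr mulr_ge0 ?(ltW p)//; lra.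
have ag := mulr_gt0 a0 g.
set E := expR (- (9 / 8 * L)) * expR (- (1 / 10) * `|x|).
have E0 : 0 < E by rewrite mulr_gt0 ?expR_gt0.
(* The cross term of the square is nonpositive, and [phi x <= 2 * mix a x] handles the Gaussian
   square. *)
have split2 : score_defect a x <= a * gconv x ^+ 2 / mix a x + 2 * (a * phi x).
  rewrite /score_defect -lerBlDl -mulrBl ler_pdivrMr//.
  have := ler_wpM2l (mulr_ge0 (ltW a0) (ltW p)) pm.
  have := mulr_ge0 (ltW ag) (ltW p); nra.
have phiE : 2 * (a * phi x) <= 4 * E.
  have -> : 4 * E = 2 * (2 * E) by ring.
  rewrite ler_pM2l// /E -expRD (@le_trans _ _ (a * (2 * expR (- `|x|))))//.
    by rewrite ler_pM2l// phi_le_expRNnormr.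
  rewrite mulrCA ler_pM2l// -expRD ler_expR.
  have := normr_ge0 x; nra.
have gE : a * gconv x ^+ 2 / mix a x <= (2 / phi 0 + 1) * E.
  (* In the tail, [a * gconv x <= mix a x] leaves [expR (- |x|)]. Keeping a tenth of the exponent
     for integrability yields the rate [9 / 8 = 9 / 10 * 5 / 4]. *)
  have [xL|xL] := lerP (5 / 4 * L) `|x|.
    apply: (@le_trans _ _ (gconv x)).
      by rewrite ler_pdivrMr//; have := ler_wpM2l (ltW g) gm; lra.
    apply: (@le_trans _ _ (1 * E)).
      by rewrite mul1r /E (le_trans (gconv_le x))// -expRD ler_expR; lra.
    by rewrite ler_pM2r// lerDr divr_ge0// ltW.
  (* In the bulk the mixture is at least [phi x / 2]; the exponent
     [L - L ^+ 2 - 2 * |x| + x ^+ 2 / 2] is then negative enough, as [(5 / 4) ^+ 2 / 2 < 1]. *)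
  apply: (@le_trans _ _ (a * gconv x ^+ 2 / (phi x / 2))).
    rewrite ler_pM2l ?mulr_gt0 ?exprn_gt0// lef_pV2 ?posrE ?(divr_gt0 p)//; lra.
  apply: (@le_trans _ _ (2 / phi 0 * E)); last by rewrite ler_pM2r// lerDl.
  rewrite (phi0E x).
  have -> : a * gconv x ^+ 2 / (phi 0 * expR (- x ^+ 2 / 2) / 2) =
     2 / phi 0 * (a * gconv x ^+ 2 / expR (- x ^+ 2 / 2)).
    by field; rewrite !gt_eqF ?expR_gt0.
  rewrite ler_pM2l ?(divr_gt0 _ p0)// -expRN.
  apply: (@le_trans _ _ (a * expR (- `|x|) ^+ 2 * expR (- (- x ^+ 2 / 2)))).
    rewrite ler_pM2r ?expR_gt0// ler_pM2l// lerXn2r ?nnegrE ?expR_ge0 ?gconv_le//.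
    exact: ltW.
  rewrite /E expr2 -!expRD ler_expR -(real_normK (num_real x)).
  have := normr_ge0 x; nra.
rewrite -mulrA -/E; apply: (le_trans split2); lra.
Qed.

(** Multiplying by [expR (- x) >= 1 - x] reduces this to [(1 + x + 2 * x ^+ 2) * (1 - x) = 1 + x ^+
    2 * (1 - 2 * x)]. *)
Lemma expR_le_quadratic x : x <= 1 / 2 -> expR x <= 1 + x + 2 * x ^+ 2.
Proof.
move=> x2; have h := expR_ge1Dx (- x); have e0 := expR_gt0 (- x).
rewrite -[x in expR x]opprK expRN -div1r ler_pdivrMr//.
have : 0 <= 1 + x + 2 * x ^+ 2 by have := sqr_ge0 (x + 1 / 2); nra.
move=> q; have := ler_wpM2l q h.
have : 0 <= x ^+ 2 * (1 - 2 * x) by rewrite mulr_ge0 ?sqr_ge0//; lra.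
nra.
Qed.

End ScoreMoments.

(** * Laplace transforms of the score for null and signal coordinates *)

Section ScoreLaplace.
Context {R : realType}.
Implicit Types (a x L kap : R).

(** One factor of the Chernoff bound for a nonpositive total score. The scale [a] makes a signal,
    whose score is about [1 / a], contribute an exponent of order [kap]. *)
Definition score_exp kap a x := expR (- (kap * a * score a x)).

Lemma score_exp_le kap a x : 0 <= kap -> 0 <= a <= 1 / 2 -> 4 * kap * a <= 1 ->
  - (kap * a * score a x) <= 1 / 2.
Proof.
move=> k0 a01 ka; have := score_ge x a01; case/andP: a01 => a0 a1.
by move=> /(ler_wpM2l (mulr_ge0 k0 a0)); lra.
Qed.

Lemma score_exp_integrable kap a t : 0 <= kap -> 0 <= a <= 1 / 2 ->
  4 * kap * a <= 1 ->
  exists v, has_integral (fun x => phi (x - t) * score_exp kap a x) v.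
Proof.
move=> k0 a01 ka.
apply: (dominated_has_integral _ _ (has_integralZ (expR (1 / 2)) (has_integral_phi t))).
  apply: measurable_funM; first exact: measurable_has_integral (has_integral_phi t).
  apply: measurableT_comp => //; apply: measurableT_comp => //.
  by apply: measurable_funM => //; apply: measurable_score; lra.
move=> x; rewrite ger0_norm ?mulr_ge0 ?phi_ge0 ?expR_ge0// mulrC.
by rewrite ler_wpM2r ?phi_ge0// ler_expR score_exp_le.
Qed.

(** A second-order expansion of the exponential: the terms in [phi] and [gconv] integrate to exactly
    1, and both the linear and the quadratic remainders are multiples of the defect. The factor 20
    is the integral of [expR (- (1 / 10) * |x|)]. *)
Lemma null_score_exp : exists2 C : R, 0 < C & forall kap L, let a := expR (L - L ^+ 2) in
  0 <= kap -> 10 <= L -> a <= 1 / 2 -> 4 * kap * a <= 1 ->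
  exists2 v, has_integral (fun x => phi (x - 0) * score_exp kap a x) v &
    v <= 1 + kap * (1 + 4 * kap) * C * (a * expR (- (9 / 8 * L))).
Proof.
have [C C0 HC] := @score_defect_le R; exists (20 * C); first by rewrite mulr_gt0.
move=> kap L a k0 L10 a12 ka.
have a0 : 0 < a by exact: expR_gt0.
have a01 : 0 <= a <= 1 / 2 by rewrite a12 ltW.
have a01' : 0 <= a <= 1 by lra.
have [v hv] := score_exp_integrable 0 k0 a01 ka; exists v => //.
set K := kap * a * (1 + 4 * kap) * (C * expR (- (9 / 8 * L))).
have := has_integralD (has_integralZ (1 + kap * a) (has_integral_phi 0))
 (has_integralD (has_integralZ (- (kap * a)) has_integral_gconvT)
   (has_integralZ K (has_integral_expRNnormr (_ : 0 < 1 / 10 :> R)))).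
move=> /(_ ltac:(lra)) H.
have -> : 1 + kap * (1 + 4 * kap) * (20 * C) * (a * expR (- (9 / 8 * L))) =
   (1 + kap * a) * 1 + (- (kap * a) * 1 + K * (2 / (1 / 10))).
  by rewrite /K; field.
apply: le_has_integral hv H => x; rewrite subr0.
set z := - (kap * a * score a x).
have z2 : z <= 1 / 2 by exact: score_exp_le.
have := ler_wpM2l (phi_ge0 x) (expR_le_quadratic z2); rewrite -/z.
have e1 : phi x * z = - (kap * a) * (gconv x - phi x - score_defect a x).
  by rewrite -phiM_score// /z; ring.
have e2 : phi x * z ^+ 2 <= 2 * kap ^+ 2 * a * score_defect a x.
  have -> : phi x * z ^+ 2 = kap ^+ 2 * a * (a * (phi x * score a x ^+ 2)).
    by rewrite /z; ring.
  have -> : 2 * kap ^+ 2 * a * score_defect a x = kap ^+ 2 * a * (2 * score_defect a x).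
    by ring.
  by rewrite ler_wpM2l ?phiM_score_sqr// mulr_ge0 ?sqr_ge0// ltW.
have d : kap * a * (1 + 4 * kap) * score_defect a x <= K * expR (- (1 / 10) * `|x|).
  rewrite /K -[leRHS]mulrA ler_wpM2l//; last exact: HC.
  by rewrite !mulr_ge0 ?(ltW a0)//; lra.
rewrite /score_exp -/z; lra.
Qed.

(** Beyond a point [X] the score is at least [1 / (2 * a)], so the exponential is at most
    [expR (- (kap / 2))]. Below [X] it is at most [expR (1 / 2)], and [t] is placed so far out that
    this region has small Gaussian mass. *)
Lemma signal_score_exp kap a : 0 <= kap -> 0 < a <= 1 / 2 -> 4 * kap * a <= 1 ->
  exists t v, has_integral (fun x => phi (x - t) * score_exp kap a x) v /\
    v <= 2 * expR (- (kap / 2)).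
Proof.
move=> k0 /andP[a0 a1] ka; have a01 : 0 <= a <= 1 / 2 by rewrite a1 ltW.
have p1 := phi_gt0 (1 : R).
pose M := 2 / (a * (phi 1 / 2 * expR (- 1))).
have M0 : 0 < M.
  by rewrite divr_gt0// mulr_gt0// mulr_gt0 ?expR_gt0// divr_gt0.
(* For [x >= X], both [x ^+ 2 / 2 >= 2 * x] and [expR x >= M] hold, so [a * gconv x] dominates
   [2 * phi x]. *)
pose X := 4 + M.
have large x : X <= x -> 1 <= 2 * a * score a x.
  move=> Xx; have x0 : 0 < x by rewrite /X in Xx; lra.
  have m : 0 < mix a x by apply: mix_gt0; lra.
  rewrite /score mulrA ler_pdivlMr// mul1r /mix.
  have key : 2 * phi x <= a * gconv x.
    apply: (@le_trans _ _ (2 * expR (- x ^+ 2 / 2))).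
      by rewrite ler_pM2l// phi0E ler_piMl ?expR_ge0 ?phi_le1.
    apply: (@le_trans _ _ (a * (phi 1 / 2 * expR (- `|x| - 1)))); last first.
      by rewrite ler_pM2l// gconv_ge.
    rewrite (ger0_norm (ltW x0)) expRD.
    have -> : a * (phi 1 / 2 * (expR (- x) * expR (- 1))) = 2 / M * expR (- x).
      rewrite /M; field; rewrite !gt_eqF ?expR_gt0//.
    rewrite -[leRHS]mulrA ler_pM2l// [leRHS]mulrC ler_pdivlMr//.
    apply: (@le_trans _ _ (expR (- x ^+ 2 / 2) * expR x)).
      rewrite ler_pM2l ?expR_gt0//.
      by have := expR_ge1Dx x; rewrite /X in Xx; lra.
    by rewrite -expRD ler_expR; rewrite /X in Xx; nra.
  by have := phi_gt0 x; have := ler_wpM2r (phi_ge0 x) a1; lra.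
pose t := X + (kap / 2 + 1).
have [v hv] := score_exp_integrable t k0 a01 ka; exists t, v; split => //.
have := has_integralD (has_integralZ (expR (- (kap / 2))) (has_integral_phi t))
  (has_integralZ (expR (1 / 2 + X - t + 1 / 2)) (has_integral_phi (t - 1))).
have -> : expR (- (kap / 2)) * 1 + expR (1 / 2 + X - t + 1 / 2) * 1 =
    2 * expR (- (kap / 2)).
  have -> : 1 / 2 + X - t + 1 / 2 = - (kap / 2) by rewrite /t; field.
  by ring.
move=> H; apply: le_has_integral hv H => x.
have [Xx|Xx] := lerP X x.
  apply: (@le_trans _ _ (expR (- (kap / 2)) * phi (x - t) + 0)); last first.
    by rewrite lerD2l mulr_ge0 ?expR_ge0 ?phi_ge0.
  rewrite addr0 mulrC ler_wpM2r ?phi_ge0// ler_expR lerN2.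
  by have := ler_wpM2l k0 (large x Xx); lra.
(* Chernoff bound for the lower tail: the indicator of [x < X] is replaced by [expR (X - x)]. *)
apply: (@le_trans _ _ (0 + phi (x - t) * expR (1 / 2 + X - x))).
  rewrite add0r ler_wpM2l ?phi_ge0// ler_expR.
  by have := score_exp_le x k0 a01 ka; lra.
apply: lerD; first by rewrite mulr_ge0 ?expR_ge0 ?phi_ge0.
rewrite (expRD _ (- x)) mulrCA (phi_subC x t) phiN_expR mulrA -expRD.
by rewrite le_eqVlt; apply/orP; left; apply/eqP; congr (expR _ * _); ring.
Qed.

End ScoreLaplace.

(** * The risk bound for a block of equal signals *)

Section LowerBound.
Context {R : realType}.
Implicit Types (a kap : R).

Lemma central_mass : exists2 p : R, 0 < p <= 1 &
  has_integral (fun x => phi (x - 0) * \1_`[(-1), 1]%classic x) p.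
Proof.
have ind01 (x : R) : 0 <= (\1_`[(-1), 1]%classic x : R) <= 1.
  by rewrite indicE; case: (_ \in _); rewrite ?lexx ?ler01.
have [p hp] : exists p : R, has_integral (fun x => phi (x - 0) * \1_`[(-1), 1]%classic x) p.
  apply: (dominated_has_integral _ _ (has_integral_phi 0)) => [|x].
    apply: measurable_funM; first exact: measurable_has_integral (has_integral_phi 0).
    exact: measurable_indic.
  have /andP[i0 i1] := ind01 x.
  by rewrite ger0_norm ?mulr_ge0 ?phi_ge0// ler_piMr ?phi_ge0.
exists p => //; apply/andP; split; last first.
  apply: le_has_integral hp (has_integral_phi 0) => x.
  by have /andP[i0 i1] := ind01 x; rewrite ler_piMr ?phi_ge0.
have p1 := phi_gt0 (1 : R).
have H := has_integralZ (phi (1 : R)) (has_integral_itv (_ : -1 <= 1 :> R)).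
apply: lt_le_trans (le_has_integral _ (H ltac:(lra)) hp).
  by rewrite mulr_gt0//; lra.
move=> x; rewrite subr0 indicE.
case: (boolP (_ \in _)) => [|_]; last by rewrite !mulr0.
rewrite inE /= in_itv /= !mulr1 => x1; apply: phi_le.
by rewrite (ger0_norm ler01) ler_norml.
Qed.

(** The null factors multiply to at most [expR 1 ^+ s], one factor [expR 1] per signal. Then
    [(q * expR 1) ^+ s] is at most its base, which is at most 1, because [s >= 1]. *)
Lemma laplace_prod_le (s N : nat) (v w q p : R) : (1 <= s)%N ->
  0 <= v -> v <= q -> 0 <= w -> w <= 1 + s%:R / (s + N)%:R ->
  q * expR 1 <= p -> p <= 1 -> v ^+ s * w ^+ N <= p.
Proof.
move=> s1 v0 vq w0 ws qp p1.
have q0 : 0 <= q by exact: le_trans v0 vq.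
have ws' : w ^+ N <= expR 1 ^+ s.
  apply: (@le_trans _ _ (expR (s%:R / (s + N)%:R) ^+ N)).
    by rewrite lerXn2r ?nnegrE ?expR_ge0// (le_trans ws)// expR_ge1Dx.
  rewrite -!expRM_natl ler_expR mulr1 mulrCA ler_piMr//.
  rewrite ler_pdivrMr ?mul1r ?ler_nat ?leq_addl// ltr0n addn_gt0.
  by rewrite (leq_trans _ s1).
apply: (@le_trans _ _ ((q * expR 1) ^+ s)).
  by rewrite exprMn ler_pM ?exprn_ge0// lerXn2r ?nnegrE.
have qe0 : 0 <= q * expR 1 by rewrite mulr_ge0 ?expR_ge0.
case: s s1 {ws ws'} => // s _; rewrite exprS (le_trans _ qp)//.
by rewrite ler_piMr// exprn_ile1// (le_trans qp).
Qed.

Definition block_signal (s : nat) (t : R) (i : nat) : R :=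
  if (i < s)%N then t else 0.

(* The indicator of a nonpositive score is bounded by the exponential of
   [- kap * a] times the score: the minorant of the risk is then a sum of
   products of functions of one coordinate, which integrates explicitly
   although [ahat] is not assumed to be measurable. *)
Lemma spike_slab_risk_ge (c p : R) (s N : nat) an ahat a kap t v w :
  (forall a x, 0 <= a <= 1 -> `|x| <= 1 ->
    ((c * a)%:E <= post_int a x (fun u => ((u - 0) ^+ 2)%:E))%E) ->
  has_integral (fun x => phi (x - 0) * \1_`[(-1), 1]%classic x) p ->
  has_integral (fun x => phi (x - t) * score_exp kap a x) v ->
  has_integral (fun x => phi (x - 0) * score_exp kap a x) w ->
  0 <= an -> is_EB_max (s + N) an ahat -> 0 <= c -> 0 < a <= 1 -> 0 <= kap ->
  ((N%:R * (c * a) * (p - v ^+ s * w ^+ N))%:E <=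
    gauss_expect (s + N) (block_signal s t)
      (fun x => post_risk (s + N) (ahat x) (block_signal s t) x))%E.
Proof.
move=> Hc Hp Hv Hw an0 EB c0 /andP[a0 a1] k0; set theta0 := block_signal s t.
(* There are [N + 1] products: index [k < N] stands for the central indicator at the null coordinate
   [s + k], and the last index [N] for the exponential penalty. *)
pose f k i := if k == N then score_exp kap a
  else if i == (s + k)%N then \1_`[(-1), 1]%classic else fun=> 1.
pose e k i := if k == N then if (i < s)%N then v else w
  else if i == (s + k)%N then p else 1.
have fe k i : has_integral (fun y => phi (y - theta0 i) * f k i y) (e k i).
  rewrite /f /e /theta0 /block_signal; case: eqP => _; first by case: ltnP.
  case: eqP => [->|_]; first by rewrite ltnNge leq_addr.
  by apply: has_integral_ext (has_integral_phi _) => x; rewrite mulr1.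
pose coef k := if k == N then - (N%:R * (c * a)) else c * a.
have ahat01 x : 0 <= ahat x <= 1.
  by have [/andP[h ->] _] := EB x; rewrite (le_trans an0 h).
have risk0 (x : nat -> R) k :
    (0 <= post_int (ahat x) (x k) (fun u => ((u - theta0 k) ^+ 2)%:E))%E.
  by apply: post_int_ge0 => // u; rewrite lee_fin sqr_ge0.
have := @gauss_expect_ge R theta0 N.+1 f e fe (s + N) coef
  (fun x => post_risk (s + N) (ahat x) theta0 x).
have -> : \sum_(k < N.+1) coef k * \prod_(i < s + N) e k i =
   N%:R * (c * a) * (p - v ^+ s * w ^+ N).
  rewrite big_ord_recr /= /coef /e eqxx big_split_ord /=.
  rewrite (eq_bigr (fun=> c * a * p)); last first.
    move=> k _; rewrite ltn_eqF// (bigD1 (rshift s k)) //= eqxx big1 ?mulr1// => i ik.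
    by case: eqP => // ie; case/eqP: ik; apply: val_inj.
  rewrite sumr_const card_ord.
  rewrite (eq_bigr (fun=> v)); last by move=> i _; rewrite ltn_ord.
  rewrite [\prod_(i < N) _](eq_bigr (fun=> w)); last first.
    by move=> i _; rewrite ltnNge leq_addr.
  by rewrite !prodr_const !card_ord -mulr_natl; ring.
apply; first by move=> x; apply: sume_ge0 => i _.
move=> x; rewrite big_ord_recr /= /coef /f eqxx.
rewrite (eq_bigr (fun k : 'I_N => c * a * \1_`[(-1), 1]%classic (x (s + k)%N))); last first.
  move=> k _; rewrite ltn_eqF// (bigD1 (rshift s k)) //= eqxx big1 ?mulr1// => i ik.
  by case: eqP => // ie; case/eqP: ik; apply: val_inj.
rewrite /score_exp -expR_sum sumrN -[X in expR (- X)]mulr_sumr.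
(* When the total score is nonpositive the penalty outweighs all [N] indicators and the minorant is
   at most 0. Otherwise [ahat x >= a], and the risk of the signal coordinates is discarded. *)
have [S0|S0] := lerP (\sum_(i < s + N) score a (x i)) 0.
  apply: (@le_trans _ _ 0%E); last by apply: sume_ge0 => i _.
  rewrite lee_fin mulNr subr_le0.
  apply: (@le_trans _ _ (N%:R * (c * a) * 1)); last first.
    rewrite ler_wpM2l ?mulr_ge0 ?(ltW a0)// -expR0 ler_expR oppr_ge0.
    by rewrite mulr_ge0_le0 ?mulr_ge0 ?(ltW a0).
  rewrite mulr1 mulr_natl -[X in _ <= _ *+ X](card_ord N) -sumr_const.
  apply: ler_sum => k _; rewrite indicE; case: (_ \in _); rewrite ?mulr1 ?mulr0//.
  by rewrite mulr_ge0// ltW.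
have a01 : 0 <= a <= 1 by rewrite (ltW a0).
have aa := EB_max_ge an0 a01 EB S0.
rewrite /post_risk [leRHS]big_split_ord /=.
rewrite EFinD; apply: (@le_trans _ _ (0%:E +
   \sum_(k < N) (c * a * \1_`[(-1), 1]%classic (x (s + k)%N))%:E)%E).
  rewrite -sumEFin addeC leeD2r// lee_fin mulNr oppr_le0.
  by rewrite !mulr_ge0 ?expR_ge0 ?(ltW a0).
apply: leeD; first by apply: sume_ge0 => i _.
apply: lee_sum => k _; rewrite indicE.
case: (boolP (_ \in _)) => [|_]; last by rewrite mulr0 risk0.
rewrite inE /= in_itv /= mulr1 => x1.
rewrite /theta0 /block_signal ltnNge leq_addr /=.
apply: le_trans (Hc _ _ (ahat01 x) _); last by rewrite ler_norml.
by rewrite lee_fin ler_wpM2l.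
Qed.

End LowerBound.

(** * Choice of the constants and conclusion *)

Theorem theorem1 (R : realType) :
  exists (D : R) (N0 : nat) (c0 : R),
    0 < D /\ (0 < N0)%N /\ 0 < c0 /\
    forall n s : nat, (N0 <= n)%N -> (1 <= s)%N -> s%:R <= c0 * n%:R ->
    forall alpha_n : R, is_alpha_n n alpha_n ->
    forall ahat : (nat -> R) -> R, is_EB_max n alpha_n ahat ->
    exists theta0 : nat -> R, in_l0 n s theta0 /\
      ((D * s%:R * expR (Num.sqrt (ln (n%:R / s%:R))))%:E <=
        gauss_expect n theta0 (fun x => post_risk n (ahat x) theta0 x))%E.
Proof.
have [c c0 Hc] := @post_int_sqr_ge R.
have [p /andP[p0 p1] Hp] := @central_mass R.
have [C C0 HC] := @null_score_exp R.
(* Chosen so that [2 * expR (- (kap / 2)) * expR 1 = 2 * expR (- (4 / p)) <= p / 2]. *)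
pose kap : R := 2 + 8 / p.
have kap0 : 0 < kap by rewrite addr_gt0// divr_gt0.
pose K := kap * (1 + 4 * kap) * C.
have K0 : 0 < K by rewrite !mulr_gt0// addr_gt0// mulr_gt0.
(* The three terms serve the defect bound, the inequality [K * expR (- (L / 8)) <= 1] and the
   condition [4 * kap * a <= 1]. *)
pose L0 := 10 + 8 * K + 4 * kap.
(* One factor [1 / 2] comes from [N >= n / 2], the other from [p - p / 2]; the sparsity constant
   forces [L >= L0]. *)
exists (c * p / 4), 1%N, (expR (- L0 ^+ 2)).
split; first by rewrite divr_gt0// mulr_gt0.
split => //; split; first exact: expR_gt0.
move=> n s _ s1 sn an [/andP[an0 _] _] ahat EB.
have s0 : 0 < s%:R :> R by rewrite ltr0n.
have n0 : 0 < n%:R :> R.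
  by have := lt_le_trans s0 sn; rewrite pmulr_rgt0 ?expR_gt0.
have ns : expR (L0 ^+ 2) <= n%:R / s%:R.
  by rewrite ler_pdivlMr// mulrC -ler_pdivlMr ?expR_gt0// mulrC -expRN.
have ns0 : 0 < n%:R / s%:R :> R by rewrite divr_gt0.
set L := Num.sqrt _.
have L0_ge0 : 0 <= L0 by rewrite /L0; lra.
have lnge : L0 ^+ 2 <= ln (n%:R / s%:R) by rewrite -ler_expR lnK// posrE.
have LL : L0 <= L.
  by rewrite -(ger0_norm L0_ge0) -sqrtr_sqr ler_sqrt// (le_trans _ lnge)// sqr_ge0.
have L2 : L ^+ 2 = ln (n%:R / s%:R) by rewrite sqr_sqrtr// (le_trans _ lnge)// sqr_ge0.
have L10 : 10 <= L by rewrite /L0 in LL; lra.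
have LK : 8 * K <= L by rewrite /L0 in LL; lra.
have Lk : 4 * kap <= L by rewrite /L0 in LL; lra.
pose a := expR (L - L ^+ 2).
have aE : a = s%:R / n%:R * expR L.
  by rewrite /a expRD expRN L2 lnK ?posrE// invf_div mulrC.
have a0 : 0 < a by exact: expR_gt0.
(* This makes [a] small against [L], whence [a <= 1 / 2] and [4 * kap * a <= L * a <= 1]. *)
have aL : a * (1 + L) <= 1.
  apply: (@le_trans _ _ (a * expR L)); first by rewrite ler_pM2l// expR_ge1Dx.
  by rewrite /a -expRD -[leRHS]expR0 ler_expR; nra.
have a12 : a <= 1 / 2 by nra.
have ka : 4 * kap * a <= 1 by nra.
have [w Hw w_le] := HC kap L (ltW kap0) L10 a12 ka.
have a012 : 0 < a <= 1 / 2 by rewrite a0.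
have [t [v [Hv v_le]]] := signal_score_exp (ltW kap0) a012 ka.
exists (block_signal s t).
have sn2 : 2 * s%:R <= n%:R :> R.
  have : 2 <= n%:R / s%:R :> R.
    by apply: le_trans ns; apply: le_trans (expR_ge1Dx _); rewrite /L0; nra.
  by rewrite ler_pdivlMr.
have sn' : (s <= n)%N by rewrite -(ler_nat R); lra.
have := subnKC sn'; set N := (n - s)%N => nE.
have NE : N%:R = n%:R - s%:R :> R by rewrite -nE natrD addrAC subrr add0r.
split.
  rewrite /in_l0 /block_signal -nE big_split_ord /= [X in (_ + X <= _)%N]big1.
    rewrite addn0 -[leqRHS]card_ord -sum1_card.
    by apply: leq_sum => i _; case: (_ != _).
  by move=> i _; rewrite ltnNge leq_addr /= eqxx.
have v0 : 0 <= v.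
  by apply: le_has_integral (@has_integral0 R) Hv => x; rewrite mulr_ge0 ?phi_ge0 ?expR_ge0.
have w0 : 0 <= w.
  by apply: le_has_integral (@has_integral0 R) Hw => x; rewrite mulr_ge0 ?phi_ge0 ?expR_ge0.
have vw : v ^+ s * w ^+ N <= p / 2.
  apply: (laplace_prod_le s1 v0 v_le w0); last by lra.
    rewrite nE (le_trans w_le)// lerD2l -/K -/a aE.
    (* The defect rate [9 / 8] exceeds 1, so the factor [expR L] in [a] is beaten by
       [expR (- (L / 8))] to spare. *)
    have -> : K * (s%:R / n%:R * expR L * expR (- (9 / 8 * L))) =
       s%:R / n%:R * (K * expR (- (L / 8))).
      have -> : - (L / 8) = L + - (9 / 8 * L) by field.
      by rewrite expRD; ring.
    rewrite ler_piMr ?divr_ge0 ?ler0n// expRN ler_pdivrMr ?expR_gt0// mul1r.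
    by have := expR_ge1Dx (L / 8); lra.
  rewrite -mulrA -expRD.
  have -> : - (kap / 2) + 1 = - (4 / p) by rewrite /kap; field; rewrite gt_eqF.
  rewrite expRN ler_pdivrMr ?expR_gt0//.
  have := expR_ge1Dx (4 / p); rewrite -(ler_pM2l p0).
  have -> : p * (1 + 4 / p) = p + 4 by field; rewrite gt_eqF.
  lra.
rewrite -nE in EB *.
apply: le_trans (spike_slab_risk_ge Hc Hp Hv Hw an0 EB (ltW c0) _ (ltW kap0)); last first.
  by rewrite a0; lra.
rewrite lee_fin NE.
have -> : c * p / 4 * s%:R * expR L = (n%:R / 2) * (c * a) * (p / 2).
  by rewrite aE; field; rewrite gt_eqF.
have ca : 0 < c * a by rewrite mulr_gt0.
rewrite ler_pM ?mulr_ge0 ?(ltW n0) ?(ltW p0) ?(ltW ca)//; try lra.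
by rewrite ler_pM2r//; lra.
Qed.
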